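(* Let $f:\mathbb{R}\to\mathbb{R}$ be a DC function. Then the distance function $d:=\operatorname{dist}(\cdot,\operatorname{graph} f)$ is DC on $\mathbb{R}^2$.
   Context: A real function $f$ defined on an open convex set $C\subset\mathbb{R}^d$ is called DC if it is the difference of two (finite, real-valued) convex functions on $C$. Here $\operatorname{graph} f=\{(x,f(x)):x\in\mathbb{R}\}\subset\mathbb{R}^2$ and, for nonempty $A\subset\mathbb{R}^2$, $\operatorname{dist}(z,A)=\inf_{a\in A}|z-a|$ with $|\cdot|$ the Euclidean norm. *)

(* Defs.v *)
From mathcomp Require Import all_boot all_order all_algebra.
From mathcomp Require Import all_classical all_reals all_analysis.

Set Implicit Arguments.
Unset Strict Implicit.
Unset Printing Implicit Defensive.

Import Order.TTheory GRing.Theory Num.Theory.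

Local Open Scope classical_set_scope.
Local Open Scope ring_scope.

(* As in the library's [convex_function], [f] is total and only its values on
   [C] matter; the notion is meant for [C] open and convex in E = R^d. *)
Definition DC (R : realType) (E : lmodType R) (C : set E) (f : E -> R) : Prop :=
  exists g h : E -> R,
    [/\ convex_function C g, convex_function C h &
        forall x, C x -> f x = g x - h x].

Notation plane R := (R^o * R^o)%type.

(* The library's norm on a product is the sup norm, hence this one. *)
Definition euclid_norm (R : realType) (z : plane R) : R :=
  Num.sqrt (z.1 ^+ 2 + z.2 ^+ 2).

Definition euclid_dist (R : realType) (A : set (plane R)) (z : plane R) : R :=
  inf [set euclid_norm (z - a) | a in A].

Definition graph (R : realType) (f : R -> R) : set (plane R) :=
  [set (x, f x) | x in [set: R]].

(* Main.v *)
Require Import Defs.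
From mathcomp Require Import all_boot all_order all_algebra.
From mathcomp Require Import all_classical all_reals all_analysis.
From mathcomp Require Import ring lra.

(** Write f = g - h with g and h convex.  A point is never strictly on both sides
of the graph, so the distance to the graph is the sum of the distance to the
hypograph of f and of the distance to the epigraph; the latter is the distance
to the hypograph of - f after the reflection (x, y) |-> (x, - y).  It remains to
write the distance d to the hypograph H of f as a difference of convex
functions of z = (x, y), and it suffices to find a convex Phi such that
  M(z) = Phi(z) - d(z) + max (y + h(x), g(x))
is convex.

Suppose first that h is affine plus a finite sum of hinges c_i (x - a_i)_+ with
c_i >= 0.  By [convex_of_touching], M is convex if at each point it is touched
from below, locally, by a convex function.
- On H, where d = 0 and the maximum is g, the function Phi + g touches M,
  because d is at most the vertical distance max (y - f(x), 0).
- Off H, let v be a nearest point, which lies on the graph.  If v is not over a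
  kink a_i, then a subgradient of g at v shows that H contains, near v, the part
  below a line; hence d is locally below an affine function that takes the same
  value at z, and no help from Phi is needed.  If v = v_i is over a_i, then H
  contains near v_i an angular sector, and d is locally below
  sup_n <n, z - v_i>, with n in the arc of unit normals between the two slopes
  at v_i ([hypograph_dist_le_arc]).  So Phi need only contain this supremum up to
  an affine function, for instance
  Phi_i(z) = sup_n <n, z - v_i> - <n_left, z - v_i>.
The point is that 0 <= Phi_i(z) <= c_i |z - v_i|, since the length of the arc is
at most the jump c_i of the slope: the curvature of the distance functions may be
unbounded, but the total size of these terms is governed by the total variation
of h'.

A fixed z must also be reached by boundedly much of that variation.  A kink
matters at z only if v_i is at least as near to z as a fixed point o of H, and
|z - o|^2 - |z - v_i|^2 is affine in z; adding a multiple of it to Phi_i and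
taking the positive part keeps the terms above and kills those with v_i far from
o ([kink_sum_le]).

For general h, approximate h locally uniformly by piecewise affine
interpolations h_n ([hinge_approx]).  The corresponding Phi_n are bounded at each
point, the distances d_n converge to d, and pointwise limits superior preserve
convexity; hence Phi = limsup Phi_n works for h
([hypograph_dist_diff_convex]). *)

Set Implicit Arguments.
Unset Strict Implicit.
Unset Printing Implicit Defensive.

Import Order.TTheory GRing.Theory Num.Theory.
Import numFieldNormedType.Exports.

Local Open Scope classical_set_scope.
Local Open Scope ring_scope.

(** * Convex functions *)

Definition convex_fun (R : realType) (E : lmodType R) (F : E -> R) :=
  forall x y t, 0 <= t -> t <= 1 ->
    F (t *: x + (1 - t) *: y) <= t * F x + (1 - t) * F y.

Section ConvexFun.
Variables (R : realType) (E : lmodType R).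
Implicit Types F G : E -> R.

Lemma convex_funP F : convex_function [set: E] F <-> convex_fun F.
Proof.
split=> [cF x y t t0 t1|cF t x y _ _].
  pose i : {i01 R} := Itv01 t0 t1.
  by have := cF i x y (mem_set I) (mem_set I).
exact: cF.
Qed.

Lemma convex_funD F G : convex_fun F -> convex_fun G ->
  convex_fun (fun z => F z + G z).
Proof.
move=> cF cG x y t t0 t1; have := cF x y t t0 t1; have := cG x y t t0 t1.
by rewrite /=; lra.
Qed.

Lemma convex_fun_max F G : convex_fun F -> convex_fun G ->
  convex_fun (fun z => Num.max (F z) (G z)).
Proof.
move=> cF cG x y t t0 t1; rewrite ge_max.
have s0 : 0 <= 1 - t by lra.
apply/andP; split.
  apply: le_trans (cF x y t t0 t1) _.
  by rewrite lerD// ler_wpM2l// le_max lexx.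
apply: le_trans (cG x y t t0 t1) _.
by rewrite lerD// ler_wpM2l// le_max lexx orbT.
Qed.

Lemma convex_fun_cst (a : R) : convex_fun (fun _ : E => a).
Proof. by move=> x y t t0 t1 /=; lra. Qed.

Lemma convex_fun_sum (I : Type) (r : seq I) (P : pred I) (F : I -> E -> R) :
  (forall i, convex_fun (F i)) ->
  convex_fun (fun z => \sum_(i <- r | P i) F i z).
Proof.
move=> cF; elim: r => [|i r IH].
  by move=> x y t t0 t1; rewrite !big_nil; lra.
move=> x y t t0 t1; rewrite !big_cons; case: (P i); last exact: IH.
exact: (convex_funD (cF i) IH).
Qed.

Lemma convex_funZ F a : 0 <= a -> convex_fun F -> convex_fun (fun z => a * F z).
Proof.
move=> a0 cF x y t t0 t1; apply: le_trans (ler_wpM2l a0 (cF x y t t0 t1)) _.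
by rewrite le_eqVlt; apply/orP; left; apply/eqP; ring.
Qed.

Lemma eq_convex_fun F G : F =1 G -> convex_fun F -> convex_fun G.
Proof. by move=> FG cF x y t t0 t1; rewrite -!FG; exact: cF. Qed.

Lemma convex_fun_line F x u : convex_fun F ->
  @convex_fun R R^o (fun t => F (x + t *: u)).
Proof.
move=> cF a b t t0 t1 /=.
rewrite [X in F X](_ : _ =
  t *: (x + (a : R) *: u) + (1 - t) *: (x + (b : R) *: u)); first exact: cF.
rewrite !scalerDr addrACA -scalerDl subrKC scale1r !scalerA -scalerDl.
by [].
Qed.

Lemma convex_midpoint F x u : convex_fun F -> F x + F x <= F (x + u) + F (x - u).
Proof.
move=> cF; have := cF (x + u) (x - u) 2^-1.
have -> : 1 - 2^-1 = 2^-1 :> R by lra.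
rewrite -scalerDr addrACA subrr addr0.
have -> : x + x = (1 + 1 : R) *: x by rewrite scalerDl scale1r.
rewrite scalerA.
have -> : 2^-1 * (1 + 1) = 1 :> R by lra.
by rewrite scale1r; lra.
Qed.

(** The limit superior as a relation, in the form that the convexity of limits
superior uses: eventually below, frequently above. *)
Definition is_limsup (u : nat -> R) (L : R) := forall e, 0 < e ->
  (exists N, forall n, (N <= n)%N -> u n < L + e) /\
  (forall N, exists2 n, (N <= n)%N & L - e < u n).

Lemma is_limsup_exists (u : nat -> R) (A B : R) :
  (exists N, forall n, (N <= n)%N -> A <= u n <= B) -> exists L, is_limsup u L.
Proof.
move=> [N0 uAB].
pose S := [set a : R | exists N, forall n, (N <= n)%N -> u n <= a].
have S0 : S !=set0 by exists B, N0 => n /uAB /andP[].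
have lS : has_lbound S.
  exists A => a [N Na]; have /andP[Au _] := uAB (maxn N N0) (leq_maxr _ _).
  exact: le_trans Au (Na _ (leq_maxl _ _)).
exists (inf S) => e e0; split.
  have [a [N Na] ae] := inf_adherent e0 (conj S0 lS).
  by exists N => n /Na un; apply: le_lt_trans un ae.
move=> N; apply: contrapT => nN.
suff : inf S <= inf S - e by lra.
apply: ge_inf => //; exists N => n Nn.
by rewrite leNgt; apply/negP => h; apply: nN; exists n.
Qed.

Lemma is_limsup_add (u v : nat -> R) (L l : R) : is_limsup u L ->
  (forall e, 0 < e -> exists N, forall n, (N <= n)%N -> `|v n - l| < e) ->
  is_limsup (fun n => u n + v n) (L + l).
Proof.
move=> uL vl e e0; have e20 : 0 < e / 2 by lra.
have [[N1 N1P] inf_u] := uL _ e20; have [N2 N2P] := vl _ e20; split.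
  exists (maxn N1 N2) => n; rewrite geq_max => /andP[/N1P + /N2P].
  by rewrite ltr_norml; lra.
move=> N; have [n + un] := inf_u (maxn N N2).
rewrite geq_max => /andP[Nn /N2P]; rewrite ltr_norml => vn; exists n => //.
by move: vn; lra.
Qed.

Lemma convex_limsup (F : nat -> E -> R) (L : E -> R) :
  (forall n, convex_fun (F n)) -> (forall z, is_limsup (F ^~ z) (L z)) ->
  convex_fun L.
Proof.
move=> cF FL x y t t0 t1; apply/ler_addgt0Pr => e e0.
have e20 : 0 < e / 2 by lra.
have [[N1 N1P] _] := FL x _ e20; have [[N2 N2P] _] := FL y _ e20.
have [_ /(_ (maxn N1 N2)) [n]] := FL (t *: x + (1 - t) *: y) _ e20.
rewrite geq_max => /andP[/N1P h1 /N2P h2] h3.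
have h4 := cF n x y t t0 t1; have s0 : 0 <= 1 - t by lra.
have := ler_wpM2l t0 (ltW h1); have := ler_wpM2l s0 (ltW h2); lra.
Qed.

End ConvexFun.

Section ConvexReal.
Variables (R : realType) (g : R -> R).
Hypothesis cg : @convex_fun R R^o g.

Lemma convex_three_slopes a b c : a < b -> b < c ->
  (c - a) * g b <= (c - b) * g a + (b - a) * g c.
Proof.
move=> ab bc; have ca0 : 0 < c - a by lra.
have ca : c - a != 0 by rewrite gt_eqF.
have t0 : 0 <= (c - b) / (c - a) by rewrite divr_ge0//; lra.
have t1 : (c - b) / (c - a) <= 1 by rewrite ler_pdivrMr//; lra.
have := cg a c t0 t1.
have -> : 1 - (c - b) / (c - a) = (b - a) / (c - a) by field.
have -> : ((c - b) / (c - a)) *: (a : R^o) + ((b - a) / (c - a)) *: (c : R^o) = b.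
  rewrite /GRing.scale/=; field; exact: ca.
rewrite -(ler_pM2l ca0).
congr (_ <= _); field; exact: ca.
Qed.

(** The supremum of the slopes of chords on the left of x is a subgradient. *)
Lemma subgradient_exists x : exists q, forall y, g x + q * (y - x) <= g y.
Proof.
pose S := [set (g x - g y) / (x - y) | y in [set y | y < x]].
have Sub y z : y < x -> x < z -> (g x - g y) / (x - y) <= (g z - g x) / (z - x).
  move=> yx xz; have d1 : 0 < x - y by lra.
  have d2 : 0 < z - x by lra.
  rewrite ler_pdivrMr// mulrAC ler_pdivlMr//.
  by have := convex_three_slopes yx xz; lra.
have S0 : S !=set0 by exists ((g x - g (x - 1)) / (x - (x - 1))), (x - 1) => //=; lra.
have uS z : x < z -> ubound S ((g z - g x) / (z - x)).
  by move=> xz _ [y /= yx <-]; exact: Sub.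
have hS : has_ubound S.
  by exists ((g (x + 1) - g x) / (x + 1 - x)); apply: uS; lra.
exists (sup S) => y; have [yx|xy|->] := ltgtP y x; last by rewrite subrr mulr0 addr0.
  have d1 : 0 < x - y by lra.
  have : (g x - g y) / (x - y) <= sup S by apply: ub_le_sup => //; exists y.
  by rewrite ler_pdivrMr//; lra.
have d2 : 0 < y - x by lra.
by have := ge_sup S0 (uS _ xy); rewrite ler_pdivlMr//; lra.
Qed.

Lemma convex_continuous : continuous g.
Proof.
move=> x; have [q qP] := subgradient_exists x.
(* Near x, the graph of g lies above a line of slope q and below the chords
   towards x - 1 and x + 1. *)
pose C := `|q| + `|g (x + 1) - g x| + `|g (x - 1) - g x| + 1.
have C0 : 0 < C by rewrite /C ltr_wpDl// !addr_ge0.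
apply/cvgrPdist_lt => e e0; near=> y.
have yx : `|y - x| < 1 by near: y; apply: cvgr_distC_lt.
have yxe : `|y - x| < e / C.
  by near: y; apply: cvgr_distC_lt => //; rewrite divr_gt0.
rewrite ltr_pdivlMr// in yxe; apply: le_lt_trans yxe.
rewrite distrC ler_norml; apply/andP; split.
  have : - (`|y - x| * `|q|) <= q * (y - x).
    by have := ler_norm (- (q * (y - x))); rewrite normrN normrM; lra.
  have := qP y; rewrite /C; have := normr_ge0 (y - x).
  move=> h1 h2 h3; have : 0 <= `|y - x| * (`|g (x + 1) - g x| + `|g (x - 1) - g x| + 1).
    by rewrite mulr_ge0// !addr_ge0.
  lra.
have [xy|yx'] := leP x y.
  have h := @cg (x + 1) x (y - x); rewrite /GRing.scale/= in h.
  have {}h : g y <= (y - x) * g (x + 1) + (1 - (y - x)) * g x.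
    have -> : y = (y - x) * (x + 1) + (1 - (y - x)) * x by ring.
    rewrite [X in _ <= X](_ : _ = (y - x) * g (x + 1) + (1 - (y - x)) * g x).
      by apply: h; move: yx; rewrite ltr_norml; lra.
    by congr (_ * _ + (1 - _) * _); ring.
  rewrite ger0_norm ?subr_ge0//.
  have : (y - x) * (g (x + 1) - g x) <= (y - x) * `|g (x + 1) - g x|.
    by rewrite ler_wpM2l ?ler_norm//; lra.
  have : 0 <= (y - x) * (`|q| + `|g (x - 1) - g x| + 1).
    by rewrite mulr_ge0// ?subr_ge0// !addr_ge0.
  rewrite /C; lra.
have h := @cg (x - 1) x (x - y); rewrite /GRing.scale/= in h.
have {}h : g y <= (x - y) * g (x - 1) + (1 - (x - y)) * g x.
  have -> : y = (x - y) * (x - 1) + (1 - (x - y)) * x by ring.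
  rewrite [X in _ <= X](_ : _ = (x - y) * g (x - 1) + (1 - (x - y)) * g x).
    by apply: h; move: yx; rewrite ltr_norml; lra.
  by congr (_ * _ + (1 - _) * _); ring.
rewrite ltr0_norm ?subr_lt0//.
have : (x - y) * (g (x - 1) - g x) <= (x - y) * `|g (x - 1) - g x|.
  by rewrite ler_wpM2l ?ler_norm//; lra.
have : 0 <= (x - y) * (`|q| + `|g (x + 1) - g x| + 1).
  by rewrite mulr_ge0// ?subr_ge0 ?ltW// !addr_ge0.
rewrite /C; lra.
Unshelve. all: by end_near. Qed.

End ConvexReal.

(** Subtracting from F its chord and a small strictly concave parabola leaves,
if F is above the chord somewhere, an interior maximum.  The convex W touching F
from below at that point makes the second difference there positive. *)
Lemma convex_of_touching (R : realType) (E : lmodType R) (F : E -> R) :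
  (forall x u, continuous (fun t : R => F (x + t *: u))) ->
  (forall x u, exists W : E -> R, [/\ convex_fun W, F x <= W x &
     \forall t \near (0 : R), W (x + t *: u) <= F (x + t *: u)]) ->
  convex_fun F.
Proof.
move=> ctsF touch x y t0 t00 t01.
pose u := x - y.
pose ch (s : R) := s * F x + (1 - s) * F y.
have lineE s : s *: x + (1 - s) *: y = y + s *: u.
  by rewrite /u scalerBr scalerBl scale1r addrC addrAC addrA.
rewrite lineE leNgt; apply/negP => above.
(* phi is F along the segment minus its chord and a parabola of curvature - eta,
   small enough to leave phi positive at t0. *)
pose eta := F (y + t0 *: u) - ch t0.
have eta0 : 0 < eta by rewrite /eta/ch; lra.
pose phi s := F (y + s *: u) - ch s - eta / 2 * (s * (1 - s)).
have cphi : continuous phi.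
  move=> s; apply: cvgB; first apply: cvgB; first exact: ctsF.
    by apply: cvgD; (apply: cvgM; last exact: cvg_cst); [exact: cvg_id|
      apply: cvgB; [exact: cvg_cst|exact: cvg_id]].
  apply: cvgM; first exact: cvg_cst.
  by apply: cvgM; [exact: cvg_id|apply: cvgB; [exact: cvg_cst|exact: cvg_id]].
have [c cin cmax] := EVT_max (@ler01 R) (continuous_subspaceT cphi).
have phi_t0 : 0 < phi t0.
  have : t0 * (1 - t0) <= 1 by nra.
  move=> /(ler_wpM2l (ltW (divr_gt0 eta0 (ltr0Sn R 1)))).
  by rewrite /phi -/eta; lra.
have phi_c : 0 < phi c.
  by apply: lt_le_trans phi_t0 (cmax _ _); rewrite in_itv/= t00 t01.
have phi0 : phi 0 = 0 by rewrite /phi /ch scale0r addr0; ring.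
have phi1 : phi 1 = 0.
  by rewrite /phi /ch scale1r /u subrKC; ring.
move: cin; rewrite in_itv/= => /andP[c0 c1].
(* phi vanishes at both ends, so its maximum point c is interior. *)
have {}c0 : 0 < c.
  by rewrite lt_neqAle c0 andbT; apply/eqP => h; move: phi_c; rewrite -h phi0 ltxx.
have {}c1 : c < 1.
  by rewrite lt_neqAle c1 andbT; apply/eqP => h; move: phi_c; rewrite h phi1 ltxx.
have [W [cW FW nW]] := touch (y + c *: u) u.
have nW' : \forall t \near (0 : R), W (y + c *: u + (- t) *: u) <= F (y + c *: u + (- t) *: u).
  have ct : -%R t @[t --> (0 : R)] --> (0 : R).
    by rewrite -[X in _ --> X]oppr0; exact: opp_continuous.
  exact: ct nW.
have [e [e0 ec e1c We We']] : exists e, [/\ 0 < e, e < c, e < 1 - c,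
    W (y + c *: u + e *: u) <= F (y + c *: u + e *: u) &
    W (y + c *: u + (- e) *: u) <= F (y + c *: u + (- e) *: u)].
  have : \forall e \near (0 : R)^'+, [/\ 0 < e, e < c, e < 1 - c,
    W (y + c *: u + e *: u) <= F (y + c *: u + e *: u) &
    W (y + c *: u + (- e) *: u) <= F (y + c *: u + (- e) *: u)].
    near=> e; split.
    - by near: e; exact: nbhs_right_gt.
    - by near: e; exact: nbhs_right_lt.
    - by near: e; apply: nbhs_right_lt; lra.
    - by near: e; apply: cvg_within nW.
    - by near: e; apply: cvg_within nW'.
  by move/filter_ex.
(* The second difference of phi at c is at least eta e^2, which is impossible at
   a maximum. *)
have mid := convex_midpoint (y + c *: u) (e *: u) cW.
have m1 : phi (c + e) <= phi c by apply: cmax; rewrite in_itv/=; lra.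
have m2 : phi (c - e) <= phi c by apply: cmax; rewrite in_itv/=; lra.
have e2 : 0 < eta / 2 * e ^+ 2 by rewrite mulr_gt0 ?exprn_gt0//; lra.
move: m1 m2 We We' mid; rewrite /phi/ch !scalerDl !scaleNr !addrA.
rewrite expr2 in e2; nra.
Unshelve. all: by end_near. Qed.

(** * The Euclidean plane *)

Definition dot (R : realType) (z w : plane R) : R := z.1 * w.1 + z.2 * w.2.

Section Euclid.
Variable R : realType.
Implicit Types (z w a o : plane R) (A : set (plane R)) (f : R -> R).

Lemma euclid_norm_ge0 z : 0 <= euclid_norm z.
Proof. exact: sqrtr_ge0. Qed.

Lemma euclid_norm_sqr z : euclid_norm z ^+ 2 = z.1 ^+ 2 + z.2 ^+ 2.
Proof. by rewrite sqr_sqrtr// addr_ge0// sqr_ge0. Qed.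

Lemma euclid_norm_le z (m : R) : 0 <= m ->
  (euclid_norm z <= m) = (z.1 ^+ 2 + z.2 ^+ 2 <= m ^+ 2).
Proof.
move=> m0; rewrite -euclid_norm_sqr ler_sqr// ?nnegrE//; exact: euclid_norm_ge0.
Qed.

Lemma euclid_normN z : euclid_norm (- z) = euclid_norm z.
Proof. by rewrite /euclid_norm/= !sqrrN. Qed.

Lemma euclid_norm0 : euclid_norm (0 : plane R) = 0.
Proof. by rewrite /euclid_norm/= expr0n/= addr0 sqrtr0. Qed.

Lemma dot_le z w : dot z w <= euclid_norm z * euclid_norm w.
Proof.
have [d0|d0] := lerP (dot z w) 0.
  by apply: le_trans d0 _; rewrite mulr_ge0// euclid_norm_ge0.
rewrite -ler_sqr ?nnegrE ?(ltW d0) ?mulr_ge0 ?euclid_norm_ge0//.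
rewrite exprMn !euclid_norm_sqr /dot.
have : 0 <= (z.1 * w.2 - z.2 * w.1) ^+ 2 by exact: sqr_ge0.
nra.
Qed.

Lemma euclid_norm_triangle z w : euclid_norm (z + w) <= euclid_norm z + euclid_norm w.
Proof.
rewrite euclid_norm_le ?addr_ge0 ?euclid_norm_ge0//.
have := dot_le z w; have := euclid_norm_sqr z; have := euclid_norm_sqr w.
by rewrite /dot/= !expr2; nra.
Qed.

Lemma euclid_norm_distC z w : euclid_norm (z - w) = euclid_norm (w - z).
Proof. by rewrite -euclid_normN opprB. Qed.

Lemma euclid_norm_dist_triangle z w a :
  euclid_norm (z - a) <= euclid_norm (z - w) + euclid_norm (w - a).
Proof. by rewrite -[z - a](subrKA w) euclid_norm_triangle. Qed.

Lemma euclid_normZ (t : R) z : euclid_norm (t *: z) = `|t| * euclid_norm z.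
Proof.
rewrite /euclid_norm/= /GRing.scale/= !exprMn -mulrDr sqrtrM ?sqr_ge0//.
by rewrite sqrtr_sqr.
Qed.

Lemma ler_fst_euclid_norm z : `|z.1| <= euclid_norm z.
Proof. by rewrite -sqrtr_sqr ler_wsqrtr// lerDl sqr_ge0. Qed.

Let has_lbound_dist A z : has_lbound [set euclid_norm (z - a) | a in A].
Proof. by exists 0 => _ [a _ <-]; exact: euclid_norm_ge0. Qed.

Lemma euclid_dist_le A z a : A a -> euclid_dist A z <= euclid_norm (z - a).
Proof. by move=> Aa; apply: ge_inf => //; exists a. Qed.

Lemma le_euclid_dist A z (m : R) : A !=set0 ->
  (forall a, A a -> m <= euclid_norm (z - a)) -> m <= euclid_dist A z.
Proof.
move=> [a0 Aa0] mA; apply: lb_le_inf; first by exists (euclid_norm (z - a0)), a0.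
by move=> _ [a Aa <-]; exact: mA.
Qed.

Lemma euclid_dist_ge0 A z : A !=set0 -> 0 <= euclid_dist A z.
Proof. by move=> A0; apply: le_euclid_dist => // a _; exact: euclid_norm_ge0. Qed.

Lemma euclid_dist_near A z (e : R) : A !=set0 -> 0 < e ->
  exists2 a, A a & euclid_norm (z - a) < euclid_dist A z + e.
Proof.
move=> [a0 Aa0] e0.
have hi : has_inf [set euclid_norm (z - a) | a in A].
  by split => //; exists (euclid_norm (z - a0)), a0.
by have [_ [a Aa <-] lt] := inf_adherent e0 hi; exists a.
Qed.

Lemma euclid_dist_lip A z w : A !=set0 ->
  euclid_dist A z <= euclid_dist A w + euclid_norm (z - w).
Proof.
move=> A0; rewrite -lerBlDr; apply: le_euclid_dist => // a Aa.
rewrite lerBlDr addrC; apply: le_trans (euclid_dist_le z Aa) _.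
exact: euclid_norm_dist_triangle.
Qed.

Lemma euclid_dist_line_continuous A z (u : plane R) : A !=set0 ->
  continuous (fun t : R => euclid_dist A (z + t *: u)).
Proof.
move=> A0 s; apply/cvgrPdist_lt => e e0.
pose n := euclid_norm u + 1.
have n0 : 0 < n by rewrite ltr_wpDl// euclid_norm_ge0.
have lip (x y : R) :
    euclid_dist A (z + x *: u) - euclid_dist A (z + y *: u) <= `|x - y| * n.
  rewrite lerBlDl; apply: le_trans (euclid_dist_lip _ (z + y *: u) A0) _.
  rewrite lerD2l opprD addrACA subrr add0r -scalerBl euclid_normZ.
  by rewrite ler_wpM2l// lerDl.
near=> t.
have : `|t - s| < e / n.
  by near: t; apply: cvgr_distC_lt => //; rewrite divr_gt0.
rewrite ltr_pdivlMr// => ts; apply: le_lt_trans ts.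
by rewrite ler_norml lerNl opprB lip distrC lip.
Unshelve. all: by end_near. Qed.

(** * Distance to a graph and to a hypograph *)

Definition hypograph f : set (plane R) := [set z | z.2 <= f z.1].

Lemma hypograph_nonempty f : hypograph f !=set0.
Proof. by exists (0, f 0); rewrite /hypograph/=. Qed.

Lemma hypograph_dist_ge0 f z : 0 <= euclid_dist (hypograph f) z.
Proof. exact/euclid_dist_ge0/hypograph_nonempty. Qed.

Lemma hypograph_dist_le_vertical f z :
  euclid_dist (hypograph f) z <= Num.max (z.2 - f z.1) 0.
Proof.
pose b : plane R := (z.1, Num.min z.2 (f z.1)).
have Hb : hypograph f b by rewrite /hypograph/= ge_min lexx orbT.
apply: le_trans (euclid_dist_le z Hb) _.
rewrite euclid_norm_le; last by rewrite le_max lexx orbT.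
rewrite /b/= subrr expr0n/= add0r.
by case: (leP z.2 (f z.1)) => h; case: (leP (z.2 - f z.1) 0) => h'; nra.
Qed.

Lemma hypograph_dist0 f z : hypograph f z -> euclid_dist (hypograph f) z = 0.
Proof.
move=> Hz; apply/eqP; rewrite eq_le hypograph_dist_ge0 andbT.
apply: le_trans (hypograph_dist_le_vertical f z) _.
by rewrite ge_max lexx subr_le0 andbT.
Qed.

(** The segment from a point above the graph to a point below it meets the
graph. *)
Lemma graph_crossing f z b : continuous f -> f z.1 <= z.2 -> hypograph f b ->
  exists t, euclid_norm (z - (t, f t)) <= euclid_norm (z - b).
Proof.
move=> cf fz fb.
pose p (s : R) : plane R := z + s *: (b - z).
have p1 s : (p s).1 = z.1 + s * (b.1 - z.1) by [].
have p2 s : (p s).2 = z.2 + s * (b.2 - z.2) by [].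
have caff (x y : R) : continuous (fun s : R => x + s * y).
  move=> s; apply: cvgD; first exact: cvg_cst.
  by apply: cvgM; [exact: cvg_id|exact: cvg_cst].
have cphi : continuous (fun s => (p s).2 - f (p s).1).
  move=> s; apply: cvgB; first exact: caff.
  by apply: continuous_comp; [exact: caff|exact: cf].
have [|s] := IVT (@ler01 R) (continuous_subspaceT cphi) (v := 0).
  rewrite !p1 !p2 !mul0r !addr0 !mul1r !subrKC.
  by rewrite ge_min le_max !subr_le0 !subr_ge0 fz [b.2 <= _]fb orbT.
rewrite in_itv/= => /andP[s0 s1] /eqP; rewrite subr_eq0 => /eqP ps.
exists (p s).1; rewrite -ps -surjective_pairing /p opprD addNKr -scalerN opprB.
by rewrite euclid_normZ ger0_norm// ler_piMl// euclid_norm_ge0.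
Qed.

(** A nearest point of the graph, whose existence is a minimization over a
compact interval, is also nearest in the hypograph by [graph_crossing]. *)
Lemma hypograph_dist_foot f z : continuous f -> f z.1 < z.2 ->
  exists al, [/\ euclid_dist (hypograph f) z = euclid_norm (z - (al, f al)),
    forall b, hypograph f b -> euclid_norm (z - (al, f al)) <= euclid_norm (z - b) &
    0 < euclid_norm (z - (al, f al))].
Proof.
move=> cf fz.
pose phi t := (z.1 - t) ^+ 2 + (z.2 - f t) ^+ 2.
have cphi : continuous phi.
  move=> t; have h1 : z.1 - x @[x --> t] --> z.1 - t.
    by apply: cvgB; [exact: cvg_cst|exact: cvg_id].
  have h2 : z.2 - f x @[x --> t] --> z.2 - f t.
    by apply: cvgB; [exact: cvg_cst|exact: cf].
  by apply: cvgD; [exact: (cvgM h1 h1)|exact: (cvgM h2 h2)].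
pose r := z.2 - f z.1; have r0 : 0 < r by rewrite subr_gt0.
have [|al _ almin] := @EVT_min _ phi (z.1 - r) (z.1 + r) _ (continuous_subspaceT cphi).
  by lra.
(* Points of the graph outside the interval are farther from z than the point
   vertically below z. *)
have {}almin t : phi al <= phi t.
  have [tin|tout] := boolP (t \in `[z.1 - r, z.1 + r]); first exact: almin.
  apply: (@le_trans _ _ (r ^+ 2)).
    have -> : r ^+ 2 = phi z.1 by rewrite /phi subrr expr0n/= add0r.
    by apply: almin; rewrite in_itv/=; lra.
  have : 0 <= (z.2 - f t) ^+ 2 by exact: sqr_ge0.
  have : r ^+ 2 <= (z.1 - t) ^+ 2.
    rewrite -[leRHS]real_normK ?num_real ?ler_sqr ?nnegrE ?(ltW r0)//.
    move: tout; rewrite in_itv/= negb_and -!ltNge => /orP[] h.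
      by rewrite ger0_norm; lra.
    by rewrite ler0_norm; lra.
  by rewrite /phi; lra.
have minH b : hypograph f b -> euclid_norm (z - (al, f al)) <= euclid_norm (z - b).
  move=> Hb; have [t tb] := graph_crossing cf (ltW fz) Hb.
  by apply: le_trans tb; rewrite /euclid_norm/= ler_wsqrtr//; exact: almin.
have Hal : hypograph f (al, f al) by rewrite /hypograph/=.
exists al; split => //.
  apply/eqP; rewrite eq_le euclid_dist_le//=.
  by apply: le_euclid_dist => //; exact: hypograph_nonempty.
rewrite lt_neqAle euclid_norm_ge0 andbT eq_sym; apply/eqP => h0.
have := euclid_norm_sqr (z - (al, f al)); rewrite h0 expr0n/= => h.
have h1 : (z.1 - al) ^+ 2 = 0.
  by have := sqr_ge0 (z.1 - al); have := sqr_ge0 (z.2 - f al); lra.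
have h2 : (z.2 - f al) ^+ 2 = 0.
  by have := sqr_ge0 (z.1 - al); have := sqr_ge0 (z.2 - f al); lra.
move/eqP: h1; rewrite sqrf_eq0 subr_eq0 => /eqP h1.
move/eqP: h2; rewrite sqrf_eq0 subr_eq0 => /eqP h2.
by move: fz; rewrite h1 h2 ltxx.
Qed.

Lemma graph_dist_above f z : continuous f -> f z.1 <= z.2 ->
  euclid_dist (graph f) z = euclid_dist (hypograph f) z.
Proof.
move=> cf fz; apply/eqP; rewrite eq_le; apply/andP; split.
  apply: le_euclid_dist; first exact: hypograph_nonempty.
  move=> b Hb; have [t] := graph_crossing cf fz Hb.
  by apply: le_trans; apply: euclid_dist_le; exists t.
apply: le_euclid_dist; first by exists (0, f 0), 0.
by move=> _ [t _ <-]; apply: euclid_dist_le; rewrite /hypograph/=.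
Qed.

Lemma graph_dist_reflect f z :
  euclid_dist (graph f) z = euclid_dist (graph (fun x => - f x)) (z.1, - z.2).
Proof.
congr inf; apply/seteqP; split => _ [_ [t _ <-] <-].
  exists (t, - f t); first by exists t.
  by rewrite /euclid_norm/= -opprD sqrrN.
exists (t, f t); first by exists t.
by rewrite /euclid_norm/= -opprD sqrrN.
Qed.

(** At most one of the two terms is nonzero, since the graph separates the two
sides. *)
Lemma graph_dist_split f z : continuous f ->
  euclid_dist (graph f) z = euclid_dist (hypograph f) z +
    euclid_dist (hypograph (fun x => - f x)) (z.1, - z.2).
Proof.
move=> cf; have [fz|fz] := leP (f z.1) z.2.
  rewrite graph_dist_above// [X in _ + X]hypograph_dist0 ?addr0//.
  by rewrite /hypograph/= lerN2.
rewrite graph_dist_reflect graph_dist_above/= ?lerN2 ?(ltW fz)//.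
  by rewrite [X in X + _]hypograph_dist0 ?add0r// /hypograph/= ltW.
by move=> x; apply: cvgN; exact: cf.
Qed.

End Euclid.

(** * Unit normals and support functions of arcs *)

Definition unit_normal (R : realType) (p : R) : plane R :=
  (- p / Num.sqrt (1 + p ^+ 2), 1 / Num.sqrt (1 + p ^+ 2)).

(** Convex in [w], and equal to the distance to a sector of the plane for [w]
outside of that sector. *)
Definition arc_support (R : realType) (lo hi : R) (w : plane R) : R :=
  sup [set dot (unit_normal p) w | p in [set p | lo <= p <= hi]].

Section Arc.
Variable R : realType.
Implicit Types (p q lo hi al : R) (z w u : plane R) (f : R -> R).

Let sqrt1_gt0 p : 0 < Num.sqrt (1 + p ^+ 2).
Proof. by rewrite sqrtr_gt0 ltr_pwDl// sqr_ge0. Qed.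

Let sqrt1_sqr p : Num.sqrt (1 + p ^+ 2) ^+ 2 = 1 + p ^+ 2.
Proof. by rewrite sqr_sqrtr// addr_ge0// sqr_ge0. Qed.

Lemma dot_unit_normal p w :
  dot (unit_normal p) w = (w.2 - p * w.1) / Num.sqrt (1 + p ^+ 2).
Proof. by rewrite /dot/=; ring. Qed.

Lemma euclid_norm_unit_normal p : euclid_norm (unit_normal p) = 1.
Proof.
rewrite /euclid_norm/= !expr_div_n sqrt1_sqr -mulrDl sqrrN expr1n addrC divff ?sqrtr1//.
by rewrite gt_eqF// ltr_pwDl// sqr_ge0.
Qed.

Lemma dot_unit_normal_le p w : dot (unit_normal p) w <= euclid_norm w.
Proof. by have := dot_le (unit_normal p) w; rewrite euclid_norm_unit_normal mul1r. Qed.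

Lemma dot_unit_normal_eq w : 0 < w.2 ->
  dot (unit_normal (- w.1 / w.2)) w = euclid_norm w.
Proof.
move=> w2; have w20 : w.2 != 0 by rewrite gt_eqF.
have E : Num.sqrt (1 + (- w.1 / w.2) ^+ 2) = euclid_norm w / w.2.
  have h : 0 <= euclid_norm w / w.2 by rewrite divr_ge0 ?euclid_norm_ge0 ?ltW.
  rewrite -(ger0_norm h) -sqrtr_sqr !expr_div_n euclid_norm_sqr; congr Num.sqrt.
  field; exact: w20.
have n0 : euclid_norm w != 0.
  apply/eqP => h; have := sqrt1_gt0 (- w.1 / w.2).
  by rewrite E h mul0r ltxx.
rewrite dot_unit_normal E.
apply: (@mulIf _ (euclid_norm w)) => //.
rewrite -[RHS]expr2 euclid_norm_sqr; field; by rewrite n0 w20.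
Qed.

(** With A and B the two square roots and X = 1 + p q, the difference of the
squares of the two sides is (A - B)^2 + 2 (A B - X) (1 - 1 / (A B)). *)
Lemma unit_normal_lip p q :
  euclid_norm (unit_normal p - unit_normal q) <= `|p - q|.
Proof.
rewrite euclid_norm_le// real_normK ?num_real//.
set A := Num.sqrt (1 + p ^+ 2); set B := Num.sqrt (1 + q ^+ 2).
have A0 : 0 < A by exact: sqrt1_gt0.
have B0 : 0 < B by exact: sqrt1_gt0.
have A2 : A ^+ 2 = 1 + p ^+ 2 by exact: sqrt1_sqr.
have B2 : B ^+ 2 = 1 + q ^+ 2 by exact: sqrt1_sqr.
have nA : A != 0 by rewrite gt_eqF.
have nB : B != 0 by rewrite gt_eqF.
have -> : (unit_normal p - unit_normal q).1 ^+ 2 + (unit_normal p - unit_normal q).2 ^+ 2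
    = 2 - 2 * (1 + p * q) / (A * B).
  rewrite /= -/A -/B.
  have -> : (- p / A - - q / B) ^+ 2 + (1 / A - 1 / B) ^+ 2 =
     (1 + p ^+ 2) / A ^+ 2 + (1 + q ^+ 2) / B ^+ 2 - 2 * (1 + p * q) / (A * B).
    by field; rewrite nA nB.
  by rewrite -A2 -B2; field; rewrite nA nB.
have AB1 : 1 <= A * B.
  have h x : 1 <= Num.sqrt (1 + x ^+ 2) :> R.
    by rewrite -[leLHS]sqrtr1 ler_wsqrtr// lerDl sqr_ge0.
  by rewrite -[leLHS]mulr1 ler_pM//; exact: h.
have X : 1 + p * q <= A * B.
  have [x0|x0] := lerP (1 + p * q) 0.
    by apply: le_trans x0 _; rewrite mulr_ge0// ltW.
  have AB0 : 0 <= A * B by apply: le_trans AB1.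
  rewrite -ler_sqr ?nnegrE ?(ltW x0)// exprMn A2 B2.
  rewrite -subr_ge0 (_ : _ - _ = (p - q) ^+ 2) ?sqr_ge0//; ring.
have -> : (p - q) ^+ 2 = A ^+ 2 + B ^+ 2 - 2 * (1 + p * q) by rewrite A2 B2; ring.
have : 0 <= (A * B - (1 + p * q)) * (1 - (A * B)^-1).
  by rewrite mulr_ge0 ?subr_ge0// invf_le1// mulr_gt0.
have -> : (A * B - (1 + p * q)) * (1 - (A * B)^-1) =
  A * B - (1 + p * q) - 1 + (1 + p * q) / (A * B) by field; rewrite nA nB.
have : 0 <= (A - B) ^+ 2 by exact: sqr_ge0.
by rewrite !expr2; lra.
Qed.

Let has_ubound_arc lo hi w :
  has_ubound [set dot (unit_normal p) w | p in [set p | lo <= p <= hi]].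
Proof. by exists (euclid_norm w) => _ [p _ <-]; exact: dot_unit_normal_le. Qed.

Lemma arc_support_ge lo hi p w : lo <= p <= hi ->
  dot (unit_normal p) w <= arc_support lo hi w.
Proof. by move=> ph; apply: ub_le_sup => //; exists p. Qed.

Lemma arc_support_le lo hi w m : lo <= hi ->
  (forall p, lo <= p <= hi -> dot (unit_normal p) w <= m) ->
  arc_support lo hi w <= m.
Proof.
move=> lh mP; apply: ge_sup; last by move=> _ [p /mP h <-].
by exists (dot (unit_normal hi) w), hi => //=; rewrite lh lexx.
Qed.

Lemma arc_support_le_norm lo hi w : lo <= hi ->
  arc_support lo hi w <= euclid_norm w.
Proof. by move=> lh; apply: arc_support_le => // p _; exact: dot_unit_normal_le. Qed.

(** By [unit_normal_lip], the arc is no wider than the interval of slopes. *)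
Lemma arc_support_le_width lo hi w : lo <= hi ->
  arc_support lo hi w - dot (unit_normal hi) w <= (hi - lo) * euclid_norm w.
Proof.
move=> lh; rewrite lerBlDr; apply: arc_support_le => // p /andP[lp ph].
rewrite -lerBlDr.
have -> : dot (unit_normal p) w - dot (unit_normal hi) w =
  dot (unit_normal p - unit_normal hi) w by rewrite /dot/=; ring.
apply: le_trans (dot_le _ _) _; rewrite ler_wpM2r ?euclid_norm_ge0//.
apply: le_trans (unit_normal_lip _ _) _.
by rewrite distrC ger0_norm ?subr_ge0// lerD2l lerN2.
Qed.

Lemma dot_affine (n v x y : plane R) (t : R) :
  dot n (t *: x + (1 - t) *: y - v) = t * dot n (x - v) + (1 - t) * dot n (y - v).
Proof. by rewrite /dot/= /GRing.scale/=; ring. Qed.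

Lemma arc_support_convex lo hi v : lo <= hi ->
  convex_fun (fun z : plane R => arc_support lo hi (z - v)).
Proof.
move=> lh x y t t0 t1; apply: arc_support_le => // p ph.
by rewrite dot_affine lerD// ler_wpM2l ?subr_ge0// arc_support_ge.
Qed.

Let affine_cvg (a b : R) : a + t * b @[t --> (0 : R)] --> a.
Proof.
rewrite -[X in _ --> X]addr0 -[X in _ + X](mul0r b).
by apply: cvgD; [exact: cvg_cst|apply: cvgM; [exact: cvg_id|exact: cvg_cst]].
Qed.

Let affine_near_gt0 (a b : R) : 0 < a -> \forall t \near (0 : R), 0 < a + t * b.
Proof.
by move=> a0; exact: (cvgr_gt a (@affine_cvg a b)).

Qed.

(** First-order condition: from a foot point no admissible direction of the
hypograph makes an acute angle with the segment to z.  The sign of [s] selects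
the side of the foot. *)
Lemma foot_first_order f al z p s :
  (forall b, hypograph f b -> euclid_norm (z - (al, f al)) <= euclid_norm (z - b)) ->
  (\forall x \near al, 0 <= s * (x - al) -> f al + p * (x - al) <= f x) ->
  s * (z.1 - al + p * (z.2 - f al)) <= 0.
Proof.
move=> foot nf.
pose e := z.1 - al + p * (z.2 - f al).
have ct := @affine_cvg al s.
rewrite leNgt; apply/negP => e0.
have {}nf : \forall t \near (0 : R)^'+,
    [/\ 0 < t, 0 < 2 * (s * e) + t * (- (s ^+ 2 * (1 + p ^+ 2))) &
       0 <= s * ((al + t * s) - al) -> f al + p * ((al + t * s) - al) <= f (al + t * s)].
  near=> t; split.
  - by near: t; exact: nbhs_right_gt.
  - by near: t; apply: cvg_within; apply: affine_near_gt0; rewrite mulr_gt0.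
  - by near: t; apply: cvg_within; exact: ct nf.
have [t [t0 lt nft]] := filter_ex nf.
have {}nft := nft _.
have Hb : hypograph f (al + t * s, f al + p * (t * s)).
  rewrite /hypograph/=; have -> : t * s = al + t * s - al by ring.
  rewrite subrKC; apply: nft.
  have -> : s * (al + t * s - al) = t * s ^+ 2 by ring.
  by rewrite mulr_ge0 ?sqr_ge0 ?(ltW t0).
have := foot _ Hb; rewrite euclid_norm_le ?euclid_norm_ge0// euclid_norm_sqr/=.
have := mulr_gt0 t0 lt; rewrite /e; nra.
Unshelve. all: by end_near. Qed.

(** Projecting onto the tangent line of slope [p] at the foot: this gives points
of the hypograph for positions near [z] on the relevant side of the normal. *)
Lemma dist_le_normal_near f al z u p s : 0 < z.2 - f al ->
  (\forall x \near al, 0 <= s * (x - al) -> f al + p * (x - al) <= f x) ->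
  z.1 - al + p * (z.2 - f al) = 0 ->
  \forall t \near (0 : R),
    0 <= s * ((z + t *: u).1 - al + p * ((z + t *: u).2 - f al)) ->
    euclid_dist (hypograph f) (z + t *: u)
      <= dot (unit_normal p) (z + t *: u - (al, f al)).
Proof.
move=> w20 nf e0.
pose D := 1 + p ^+ 2; have D0 : 0 < D by rewrite ltr_pwDl// sqr_ge0.
pose tau t := t * ((u.1 + p * u.2) / D).
have ct : al + tau t @[t --> (0 : R)] --> al by exact: affine_cvg.
have tauE t : tau t = ((z + t *: u).1 - al + p * ((z + t *: u).2 - f al)) / D.
  rewrite /tau/= /GRing.scale/= mulrA; congr (_ / D); lra.
have nfc : 0 < (z.2 - f al) - p * (z.1 - al).
  have -> : z.1 - al = - (p * (z.2 - f al)) by lra.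
  have : 0 <= p ^+ 2 * (z.2 - f al) by rewrite mulr_ge0 ?sqr_ge0 ?ltW.
  by rewrite expr2; lra.
have nfc' := affine_near_gt0 (u.2 - p * u.1) nfc.
have nf' := ct _ nf.
near=> t => side.
have h1 : 0 < (z.2 - f al) - p * (z.1 - al) + t * (u.2 - p * u.1) by near: t.
have h2 : 0 <= s * ((al + tau t) - al) -> f al + p * ((al + tau t) - al) <= f (al + tau t).
  by near: t; exact: nf'.
have Hb : hypograph f (al + tau t, f al + p * tau t).
  rewrite /hypograph/=; move: h2; rewrite [al + tau t - al]addrC addKr; apply.
  by rewrite tauE mulrA divr_ge0// ltW.
apply: le_trans (euclid_dist_le _ Hb) _.
set w := z + t *: u - (al, f al).
have w1 : (z + t *: u).1 = al + w.1 by rewrite /w/=; ring.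
have w2 : (z + t *: u).2 = f al + w.2 by rewrite /w/=; ring.
have w0 : 0 < w.2 - p * w.1 by move: h1; rewrite /w/= /GRing.scale/=; lra.
rewrite dot_unit_normal euclid_norm_le; last by rewrite divr_ge0 ?ltW.
have tauw : tau t = (w.1 + p * w.2) / D.
  by rewrite tauE w1 w2; congr (_ / D); ring.
have c1 : (z + t *: u - (al + tau t, f al + p * tau t)).1 = w.1 - tau t.
  by rewrite /w/=; ring.
have c2 : (z + t *: u - (al + tau t, f al + p * tau t)).2 = w.2 - p * tau t.
  by rewrite /w/=; ring.
rewrite c1 c2 expr_div_n sqrt1_sqr -/D tauw.
move: (w.1 : R) (w.2 : R) => a b.
rewrite le_eqVlt; apply/orP; left; apply/eqP; rewrite /D; field.
by rewrite -/D gt_eqF.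
Unshelve. all: by end_near. Qed.

(** Near its foot the hypograph contains a sector with edges of slopes [hi] (on
the left) and [lo] (on the right), and a point near [z] lies in the normal cone
at the vertex, or projects onto one of the two edges.  In the second case the
foot is still close to the vertex: when [z] itself is not on the corresponding
boundary ray of the normal cone, points near it are not beyond that ray. *)
Lemma hypograph_dist_le_arc f al z u lo hi :
  0 < euclid_norm (z - (al, f al)) ->
  (forall b, hypograph f b -> euclid_norm (z - (al, f al)) <= euclid_norm (z - b)) ->
  (\forall x \near al, x <= al -> f al + hi * (x - al) <= f x) ->
  (\forall x \near al, al <= x -> f al + lo * (x - al) <= f x) ->
  \forall t \near (0 : R), euclid_dist (hypograph f) (z + t *: u)
    <= arc_support lo hi (z + t *: u - (al, f al)).
Proof.
move=> r0 foot nhi nlo.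
have {}nhi : \forall x \near al, 0 <= -1 * (x - al) -> f al + hi * (x - al) <= f x.
  by near=> x => h; have : x <= al by [lra|]; near: x; exact: nhi.
have {}nlo : \forall x \near al, 0 <= 1 * (x - al) -> f al + lo * (x - al) <= f x.
  by near=> x => h; have : al <= x by [lra|]; near: x; exact: nlo.
have ehi := foot_first_order foot nhi.
have elo := foot_first_order foot nlo.
have w20 : 0 < z.2 - f al.
  have w2 : 0 <= z.2 - f al.
    rewrite leNgt; apply/negP => w2.
    have Hb : hypograph f (al, z.2) by rewrite /hypograph/=; lra.
    have := foot _ Hb; rewrite euclid_norm_le ?euclid_norm_ge0// euclid_norm_sqr/=.
    by rewrite subrr expr0n/= addr0; nra.
  rewrite lt_neqAle w2 andbT; apply/eqP => w2'; move: r0.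
  rewrite (_ : z - _ = 0) ?euclid_norm0 ?ltxx//.
  have w1 : z.1 - al = 0 by move: ehi elo; rewrite -w2' !mulr0; lra.
  by apply/eqP; rewrite -pair_eqE/=; apply/andP; split; apply/eqP; rewrite ?w1 -?w2'.
have nw2 := affine_near_gt0 u.2 w20.
have Nhi : \forall t \near (0 : R),
    (z + t *: u).1 - al + hi * ((z + t *: u).2 - f al) <= 0 ->
    euclid_dist (hypograph f) (z + t *: u)
      <= dot (unit_normal hi) (z + t *: u - (al, f al)).
  have [e|e] := ltrP 0 (z.1 - al + hi * (z.2 - f al)).
    have := affine_near_gt0 (u.1 + hi * u.2) e; apply: filterS => t /=.
    by rewrite /GRing.scale/=; lra.
  have e0 : z.1 - al + hi * (z.2 - f al) = 0 by lra.
  have := dist_le_normal_near u w20 nhi e0; apply: filterS => t ht h.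
  by apply: ht; lra.
have Nlo : \forall t \near (0 : R),
    0 <= (z + t *: u).1 - al + lo * ((z + t *: u).2 - f al) ->
    euclid_dist (hypograph f) (z + t *: u)
      <= dot (unit_normal lo) (z + t *: u - (al, f al)).
  have [e|e] := ltrP 0 (- (z.1 - al + lo * (z.2 - f al))).
    have := affine_near_gt0 (- (u.1 + lo * u.2)) e; apply: filterS => t /=.
    by rewrite /GRing.scale/=; lra.
  have e0 : z.1 - al + lo * (z.2 - f al) = 0 by lra.
  have := dist_le_normal_near u w20 nlo e0; apply: filterS => t ht h.
  by apply: ht; lra.
have lohi : lo <= hi.
  by rewrite -(ler_pM2r w20); lra.
near=> t.
have w2 : 0 < z.2 - f al + t * u.2 by near: t.
have hhi : (z + t *: u).1 - al + hi * ((z + t *: u).2 - f al) <= 0 ->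
    euclid_dist (hypograph f) (z + t *: u)
      <= dot (unit_normal hi) (z + t *: u - (al, f al)) by near: t; exact: Nhi.
have hlo : 0 <= (z + t *: u).1 - al + lo * ((z + t *: u).2 - f al) ->
    euclid_dist (hypograph f) (z + t *: u)
      <= dot (unit_normal lo) (z + t *: u - (al, f al)) by near: t; exact: Nlo.
set zt := z + t *: u; set w := zt - (al, f al).
have w2' : 0 < w.2 by move: w2; rewrite /w/zt/= /GRing.scale/=; lra.
have [e1|e1] := lerP (w.1 + hi * w.2) 0.
  apply: (@le_trans _ _ (dot (unit_normal hi) w)).
    exact: hhi.
  by apply: arc_support_ge; rewrite lohi lexx.
have [e2|e2] := lerP 0 (w.1 + lo * w.2).
  apply: (@le_trans _ _ (dot (unit_normal lo) w)).
    exact: hlo.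
  by apply: arc_support_ge; rewrite lohi lexx.
have Hv : hypograph f (al, f al) by rewrite /hypograph/=.
apply: le_trans (euclid_dist_le _ Hv) _; rewrite -/w -(dot_unit_normal_eq w2').
apply: arc_support_ge; rewrite ler_pdivlMr// ler_pdivrMr//; lra.
Unshelve. all: by end_near. Qed.

End Arc.

(** * The case of finitely many concave kinks *)

Definition hinge (R : realType) (m : nat) (A B : R) (c a : 'I_m -> R) (x : R) : R :=
  A + B * x + \sum_i c i * Num.max (x - a i) 0.

Section Hinge.
Variables (R : realType) (m : nat) (A B : R) (c a : 'I_m -> R).
Hypothesis c0 : forall i, 0 <= c i.
Local Notation k := (hinge A B c a).

Lemma hinge_convex : @convex_fun R R^o k.
Proof.
apply: convex_funD; first by move=> x y t _ _; rewrite /GRing.scale/=; lra.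
apply: convex_fun_sum => i; apply: convex_funZ (c0 i) _.
apply: convex_fun_max (convex_fun_cst _); move=> x y t _ _.
by rewrite /GRing.scale/=; lra.
Qed.

Definition left_slope al := B + \sum_(i | a i < al) c i.
Definition jump al := \sum_(i | a i == al) c i.

Let kinks_near al : \forall x \near al, forall i,
  (a i < al -> a i < x) /\ (al < a i -> x < a i).
Proof.
have near1 i : \forall x \near al, (a i < al -> a i < x) /\ (al < a i -> x < a i).
  have [ai|ai|->] := ltgtP (a i) al.
- near=> x; split => // _.
  by near: x; exact: lt_nbhsr.
- near=> x; split => // _.
  by near: x; exact: lt_nbhsl.
- by near=> x.
exact: filter_forall near1.
Unshelve. all: by end_near. Qed.

Lemma hinge_left al : \forall x \near al,
  x <= al -> k x = k al + left_slope al * (x - al).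
Proof.
near=> x => xal; rewrite /hinge /left_slope mulrDl.
rewrite [\sum_(i | a i < al) c i]big_mkcond/= mulr_suml.
have kx : forall i, (a i < al -> a i < x) /\ (al < a i -> x < a i) by near: x; exact: kinks_near.
rewrite (eq_bigr (fun i => c i * Num.max (al - a i) 0 +
  (if a i < al then c i else 0) * (x - al))); first by rewrite big_split/=; ring.
move=> i _; have [k1 k2] := kx i; case: ltP => ai.
  by have := k1 ai => ai'; rewrite !max_l ?subr_ge0 ?ltW//; ring.
by rewrite !max_r ?subr_le0//; [ring|exact: le_trans ai].
Unshelve. all: by end_near. Qed.

Lemma hinge_right al : \forall x \near al,
  al <= x -> k x = k al + (left_slope al + jump al) * (x - al).
Proof.
near=> x => xal; rewrite /hinge /left_slope /jump !mulrDl.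
rewrite [\sum_(i | a i < al) c i]big_mkcond [\sum_(i | a i == al) c i]big_mkcond/=.
rewrite !mulr_suml.
have kx : forall i, (a i < al -> a i < x) /\ (al < a i -> x < a i) by near: x; exact: kinks_near.
rewrite (eq_bigr (fun i => c i * Num.max (al - a i) 0 +
  ((if a i < al then c i else 0) * (x - al) + (if a i == al then c i else 0) * (x - al)))).
  by rewrite !big_split/=; ring.
move=> i _; have [k1 k2] := kx i; case: (ltgtP (a i) al) => ai.
- have := k1 ai => ai'; rewrite !max_l ?subr_ge0 ?ltW//; ring.
- have := k2 ai => ai'; rewrite !max_r ?subr_le0 ?ltW//; ring.
- by rewrite ai !max_l ?subr_ge0//; ring.
Unshelve. all: by end_near. Qed.

(** With step 2 rho, every hinge has a nonnegative second difference at 0, which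
is at least rho if the kink is within rho of 0. *)
Lemma hinge_mass_le (rho : R) : 0 <= rho ->
  rho * (\sum_(i | `|a i| < rho) c i) <= k (2 * rho) + k (- (2 * rho)) - 2 * k 0.
Proof.
move=> rho0; rewrite /hinge big_mkcond/= mulr_sumr.
rewrite [leRHS](_ : _ = \sum_i (c i * Num.max (2 * rho - a i) 0 +
  c i * Num.max (- (2 * rho) - a i) 0 - 2 * (c i * Num.max (0 - a i) 0))).
  apply: ler_sum => i _.
  rewrite [leRHS](_ : _ = c i * (Num.max (2 * rho - a i) 0 +
     Num.max (- (2 * rho) - a i) 0 - 2 * Num.max (0 - a i) 0)); last by ring.
  have m1 : 0 <= Num.max (2 * rho - a i) 0 by rewrite le_max lexx orbT.
  have m1' : 2 * rho - a i <= Num.max (2 * rho - a i) 0 by rewrite le_max lexx.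
  have m2 : 0 <= Num.max (- (2 * rho) - a i) 0 by rewrite le_max lexx orbT.
  have m2' : - (2 * rho) - a i <= Num.max (- (2 * rho) - a i) 0.
    by rewrite le_max lexx.
  case: ifP => [|_]; last first.
    by rewrite mulr0 mulr_ge0//; case: (leP (0 - a i) 0); lra.
  rewrite ltr_norml => /andP[h1 h2]; rewrite mulrC ler_wpM2l//.
  by case: (leP (0 - a i) 0); lra.
by rewrite sumrB big_split/= -mulr_sumr; ring.
Qed.

End Hinge.

Section HingeGraph.
Variables (R : realType) (g : R -> R) (m : nat) (A B : R) (c a : 'I_m -> R).
Hypothesis cg : @convex_fun R R^o g.
Hypothesis c0 : forall i, 0 <= c i.
Hypothesis inja : injective a.
Local Notation k := (hinge A B c a).
Let f x := g x - k x.
Variable o : plane R.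
Hypothesis Ho : hypograph f o.
Hypothesis o1 : o.1 = 0.

Let q x := projT1 (cid (subgradient_exists cg x)).
Let qP x y : g x + q x * (y - x) <= g y.
Proof. by rewrite /q; case: cid => ? /=; apply. Qed.

Let hi al := q al - left_slope B c a al.
Let lo al := hi al - jump c a al.

Let jump_ge0 al : 0 <= jump c a al.
Proof. exact: sumr_ge0. Qed.

Let lo_le_hi al : lo al <= hi al.
Proof. by rewrite /lo gerBl. Qed.

Let jump_vertex i : jump c a (a i) = c i.
Proof.
by rewrite /jump (big_pred1 i)// => j; rewrite (inj_eq inja).
Qed.

Let f_left al : \forall x \near al, x <= al -> f al + hi al * (x - al) <= f x.
Proof.
have := hinge_left A B c a al; apply: filterS => x h /h; rewrite /f /hi => ->.
by have := qP al x; lra.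
Qed.

Let f_right al : \forall x \near al, al <= x -> f al + lo al * (x - al) <= f x.
Proof.
have := hinge_right A B c a al; apply: filterS => x h /h; rewrite /f /lo /hi => ->.
by have := qP al x; lra.
Qed.

Let f_continuous : continuous f.
Proof.
move=> x; apply: cvgB; [exact: convex_continuous|].
exact: (convex_continuous (hinge_convex A B a c0)).
Qed.

Let vertex i : plane R := (a i, f (a i)).

(** Affine in z, and nonnegative where z is closer to the vertex than to o. *)
Let bisector i (z : plane R) : R :=
  euclid_norm (z - o) ^+ 2 - euclid_norm (z - vertex i) ^+ 2.

Let bisector_affine i x y t : bisector i (t *: x + (1 - t) *: y) =
  t * bisector i x + (1 - t) * bisector i y.
Proof. by rewrite /bisector !euclid_norm_sqr/= /GRing.scale/=; ring. Qed.

Let normal_part i (z : plane R) : R :=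
  4 * c i * bisector i z - dot (unit_normal (hi (a i))) (z - vertex i).

Let normal_part_convex i : convex_fun (normal_part i).
Proof.
move=> x y t t0 t1; rewrite /normal_part bisector_affine dot_affine.
by rewrite le_eqVlt; apply/orP; left; apply/eqP; ring.
Qed.

(** The factor 4 makes the affine term dominate far from o, see
[kink_sum_le]; the positive part then removes the far kinks. *)
Let kink_term i (z : plane R) : R :=
  Num.max (arc_support (lo (a i)) (hi (a i)) (z - vertex i) + normal_part i z) 0.

Definition kink_sum (z : plane R) : R := \sum_i kink_term i z.

Let kink_term_convex i : convex_fun (kink_term i).
Proof.
apply: convex_fun_max (convex_fun_cst _); apply: convex_funD => //.
exact: arc_support_convex.
Qed.

Lemma kink_sum_convex : convex_fun kink_sum.
Proof. exact: convex_fun_sum. Qed.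

Let base (z : plane R) := Num.max (z.2 + k z.1) (g z.1).

Let upper_convex : convex_fun (fun z : plane R => z.2 + k z.1).
Proof.
apply: convex_funD; first by move=> x y t _ _; rewrite /= /GRing.scale/=; lra.
by move=> x y t t0 t1; exact: (hinge_convex A B a c0).
Qed.

Let lower_convex : convex_fun (fun z : plane R => g z.1).
Proof. by move=> x y t t0 t1; exact: cg. Qed.

Let base_convex : convex_fun base.
Proof. exact: convex_fun_max. Qed.

(** On the hypograph, the kink of the distance along the graph is compensated by
the one of max (y + k, g) = g + max (y - f, 0). *)
Let kink_touch_below z : z.2 <= f z.1 -> forall u, exists W : plane R -> R,
  [/\ convex_fun W,
    kink_sum z - euclid_dist (hypograph f) z + base z <= W z &
    \forall t \near (0 : R), W (z + t *: u) <= kink_sum (z + t *: u) -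
      euclid_dist (hypograph f) (z + t *: u) + base (z + t *: u)].
Proof.
move=> Hz u; exists (fun w => kink_sum w + g w.1); split.
- exact: convex_funD kink_sum_convex lower_convex.
- rewrite hypograph_dist0// subr0 lerD2l /base ge_max lexx andbT.
  by move: Hz; rewrite /f; lra.
- near=> t; move: (z + t *: u) => w.
  have := hypograph_dist_le_vertical f w.
  rewrite /base /f; case: (leP _ 0); case: (leP _ (g w.1)); lra.
Unshelve. all: by end_near. Qed.

(** Above the graph only the term of the kink at the foot has to absorb the
distance; the remaining terms of the sum are convex by themselves. *)
Let kink_touch_above z : f z.1 < z.2 -> forall u, exists W : plane R -> R,
  [/\ convex_fun W,
    kink_sum z - euclid_dist (hypograph f) z + base z <= W z &
    \forall t \near (0 : R), W (z + t *: u) <= kink_sum (z + t *: u) -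
      euclid_dist (hypograph f) (z + t *: u) + base (z + t *: u)].
Proof.
move=> fz u.
have [al [dE foot r0]] := hypograph_dist_foot f_continuous fz.
have arc := hypograph_dist_le_arc u r0 foot (f_left al) (f_right al).
have baseE : base z = z.2 + k z.1.
  by rewrite /base max_l//; move: fz; rewrite /f; lra.
have base_ge w : w.2 + k w.1 <= base w by rewrite /base le_max lexx.
have [[i ai]|noi] := pselect (exists i, a i = al).
  (* The foot is a vertex: the positive part of its term is inactive at z, since
     z is nearer to the foot than to o. *)
  subst al; rewrite -/(vertex i) in dE foot r0 arc.
  pose rest w := \sum_(j | j != i) kink_term j w.
  have sumE w : kink_sum w = kink_term i w + rest w.
    by rewrite /kink_sum (bigD1 i).
  exists (fun w => rest w + normal_part i w + (w.2 + k w.1)); split.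
  - apply: convex_funD upper_convex; apply: convex_funD => //.
    exact: convex_fun_sum.
  - rewrite sumE dE baseE /kink_term max_l.
      by have := arc_support_le_norm (z - vertex i) (lo_le_hi (a i)); lra.
    rewrite /normal_part.
    have : 0 <= bisector i z.
      rewrite /bisector subr_ge0 ler_sqr ?nnegrE ?euclid_norm_ge0//.
      exact: foot.
    move=> /(mulr_ge0 (mulr_ge0 (ler0n R 4) (c0 i))).
    have : lo (a i) <= hi (a i) <= hi (a i) by rewrite lo_le_hi lexx.
    by move=> /(arc_support_ge (z - vertex i)); lra.
  - near=> t.
    have : euclid_dist (hypograph f) (z + t *: u)
      <= arc_support (lo (a i)) (hi (a i)) (z + t *: u - vertex i) by near: t.
    move: (z + t *: u) => w; rewrite sumE; have := base_ge w.
    have : arc_support (lo (a i)) (hi (a i)) (w - vertex i) + normal_part i w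
      <= kink_term i w by rewrite le_max lexx.
    lra.
(* The foot is not over a kink: the arc is a single normal. *)
have loE : lo al = hi al.
  rewrite /lo /jump big1 ?subr0// => i /eqP ai.
  by case: noi; exists i.
pose n w := dot (unit_normal (hi al)) (w - (al, f al)).
exists (fun w => kink_sum w - n w + (w.2 + k w.1)); split.
- apply: convex_funD upper_convex; apply: convex_funD; first exact: kink_sum_convex.
  move=> x y t _ _; rewrite /n dot_affine.
  by rewrite le_eqVlt; apply/orP; left; apply/eqP; ring.
- rewrite baseE dE; have := dot_unit_normal_le (hi al) (z - (al, f al)).
  by rewrite /n; lra.
- near=> t.
  have : euclid_dist (hypograph f) (z + t *: u)
      <= arc_support (lo al) (hi al) (z + t *: u - (al, f al)) by near: t.
  move: (z + t *: u) => w; have := base_ge w.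
  have : arc_support (lo al) (hi al) (w - (al, f al)) <= n w.
    apply: arc_support_le => // p; rewrite loE => /andP[p1 p2].
    by have -> : p = hi al by apply/eqP; rewrite eq_le p1 p2.
  lra.
Unshelve. all: by end_near. Qed.

Lemma kink_sum_sub_dist_convex :
  convex_fun (fun z => kink_sum z - euclid_dist (hypograph f) z + base z).
Proof.
have ctsC (F : plane R -> R) x u : convex_fun F -> continuous (fun t : R => F (x + t *: u)).
  by move=> cF; exact: (convex_continuous (convex_fun_line x u cF)).
apply: convex_of_touching => [x u t|z u].
  apply: cvgD; [apply: cvgB|].
  - exact: (ctsC _ x u kink_sum_convex).
  - exact: (@euclid_dist_line_continuous R _ x u (hypograph_nonempty f) t).
  - exact: (ctsC _ x u base_convex).
by have [Hz|Hz] := leP z.2 (f z.1); [exact: kink_touch_below|exact: kink_touch_above].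
Qed.

Lemma kink_sum_ge0 z : 0 <= kink_sum z.
Proof. by apply: sumr_ge0 => i _; rewrite le_max lexx orbT. Qed.

(** Far from o the term 4 c_i (|z - o|^2 - |z - v_i|^2) outweighs the support
function, so only the kinks near o contribute. *)
Lemma kink_sum_le z rho : 1 <= rho -> 4 * euclid_norm (z - o) <= rho ->
  kink_sum z <= (2 + 4 * rho) * (k (2 * rho) + k (- (2 * rho)) - 2 * k 0).
Proof.
move=> rho1 zrho; have rho0 : 0 <= rho by lra.
apply: (@le_trans _ _ ((2 + 4 * rho) * (rho * (\sum_(i | `|a i| < rho) c i)))); last first.
  by rewrite ler_wpM2l ?hinge_mass_le//; lra.
rewrite big_mkcond/= !mulr_sumr; apply: ler_sum => i _.
set V := euclid_norm (vertex i - o); set D := euclid_norm (z - o).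
set E := euclid_norm (z - vertex i).
have D0 : 0 <= D by exact: euclid_norm_ge0.
have E0 : 0 <= E by exact: euclid_norm_ge0.
have ED : E <= D + V.
  by rewrite /V euclid_norm_distC; exact: euclid_norm_dist_triangle.
have VDE : V <= D + E.
  by rewrite addrC /E euclid_norm_distC; exact: euclid_norm_dist_triangle.
have aV : `|a i| <= V.
  by have := ler_fst_euclid_norm (vertex i - o); rewrite /= o1 subr0.
have phi : arc_support (lo (a i)) (hi (a i)) (z - vertex i) + normal_part i z <=
    c i * (E + 4 * (D ^+ 2 - E ^+ 2)).
  have := arc_support_le_width (z - vertex i) (lo_le_hi (a i)).
  rewrite {2}/lo opprB addrCA subrr addr0 jump_vertex -/E /normal_part.
  by rewrite /bisector -/D -/E; lra.
have ci := c0 i.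
rewrite ge_max; apply/andP; split; last by case: ifP => _; rewrite ?mulr0// !mulr_ge0//; lra.
apply: le_trans phi _.
have [Vr|Vr] := ltP V rho.
  rewrite (le_lt_trans aV Vr).
  rewrite [leRHS](_ : _ = c i * ((2 + 4 * rho) * rho)); last by ring.
  rewrite ler_wpM2l//; rewrite -/D in zrho; nra.
apply: (@le_trans _ _ 0); last by case: ifP => _; rewrite ?mulr0// !mulr_ge0//; lra.
rewrite mulr_ge0_le0//; rewrite -/D in zrho; nra.
Qed.

End HingeGraph.

(** * Approximation by finitely many kinks *)

Section Approximation.
Variable R : realType.
Implicit Types (f g h k : R -> R) (z : plane R).

Definition is_hinge k := exists m A B (c a : 'I_m -> R),
  [/\ forall i, 0 <= c i, injective a & k = hinge A B c a].

(** Piecewise affine interpolation at the nodes [- T + j d]: the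
subgradients of [h] at [- T] and [T + 1] bound all slopes that occur, so the error is
at most their difference times the mesh [d]. *)
Lemma hinge_approx h (T e : R) : @convex_fun R R^o h -> 0 < T -> 0 < e ->
  exists2 k, is_hinge k & forall x, `|x| <= T -> `|k x - h x| <= e.
Proof.
move=> ch T0 e0.
have /choice[q qP] : forall x, exists q, forall y, h x + q * (y - x) <= h y.
  exact: subgradient_exists.
have q_mono x y : x <= y -> q x <= q y.
  rewrite le_eqVlt => /predU1P[->//|xy].
  have yx : 0 < y - x by lra.
  by rewrite -(ler_pM2r yx); have := qP x y; have := qP y x; lra.
pose K := q (T + 1) - q (- T) + 1.
have K1 : 1 <= K by have : q (- T) <= q (T + 1) by [apply: q_mono; lra]; rewrite /K; lra.
pose d := Num.min 1 (e / K).
have d0 : 0 < d by rewrite lt_min ltr01 divr_gt0//; lra.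
have d1 : d <= 1 by rewrite ge_min lexx.
have dK : d * K <= e by rewrite -ler_pdivlMr ?ge_min ?lexx ?orbT//; lra.
have dn0 : d != 0 by rewrite gt_eqF.
pose x_ (j : nat) : R := - T + j%:R * d.
have x_S j : x_ j.+1 = x_ j + d by rewrite /x_ -natr1; ring.
pose s j := (h (x_ j.+1) - h (x_ j)) / d.
have sE j : s j * d = h (x_ j.+1) - h (x_ j) by rewrite /s divfK.
have s_mono j : s j <= s j.+1.
  rewrite -(ler_pM2r d0) !sE.
  have l1 : x_ j < x_ j.+1 by rewrite x_S; lra.
  have l2 : x_ j.+1 < x_ j.+2 by rewrite [x_ j.+2]x_S; lra.
  have := convex_three_slopes ch l1 l2; rewrite !x_S.
  rewrite (_ : x_ j + d + d - x_ j = 2 * d); last by ring.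
  rewrite (_ : x_ j + d + d - (x_ j + d) = d); last by ring.
  rewrite (_ : x_ j + d - x_ j = d); last by ring.
  by rewrite -mulrDr mulrAC [_ * d]mulrC ler_pM2l//; lra.
pose m := (Num.truncn (2 * T / d)).+1.
pose c (i : 'I_m) := s i.+1 - s i.
pose a (i : 'I_m) := x_ i.+1.
exists (hinge (h (x_ 0) - s 0%N * x_ 0) (s 0%N) c a).
  exists m, (h (x_ 0) - s 0%N * x_ 0), (s 0%N), c, a; split => // [i|i j].
    by rewrite subr_ge0.
  move=> /addrI /(mulIf dn0) /eqP; rewrite eqr_nat eqSS => /eqP; exact: val_inj.
move=> x; rewrite ler_norml => /andP[x1 x2].
pose j := Num.truncn ((x + T) / d).
have xT0 : 0 <= (x + T) / d by rewrite divr_ge0 ?(ltW d0)//; lra.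
have /andP[j1 j2] := truncn_itv xT0; rewrite -/j in j1 j2.
rewrite ler_pdivlMr// in j1; rewrite ltr_pdivrMr// in j2.
have xj1 : x_ j <= x by rewrite /x_; lra.
have xj2 : x <= x_ j.+1 by rewrite x_S /x_; rewrite -natr1 mulrDl in j2; lra.
have jm : (j <= m)%N.
  by apply/leqW/le_truncn; rewrite ler_pM2r ?invr_gt0//; lra.
have kE : hinge (h (x_ 0) - s 0%N * x_ 0) (s 0%N) c a x = h (x_ j) + s j * (x - x_ j).
  have partial n : h (x_ 0) - s 0%N * x_ 0 + s 0%N * x +
      \sum_(0 <= i < n) (s i.+1 - s i) * (x - x_ i.+1) = h (x_ n) + s n * (x - x_ n).
    elim: n => [|n IH]; first by rewrite big_geq//; ring.
    rewrite big_nat_recr//= addrA IH.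
    have -> : h (x_ n.+1) = h (x_ n) + s n * (x_ n.+1 - x_ n).
      by rewrite [in x_ n.+1 - _]x_S addrAC subrr add0r sE; ring.
    by ring.
  rewrite -partial /hinge; congr (_ + _).
  rewrite -(big_mkord xpredT (fun i => (s i.+1 - s i) * Num.max (x - x_ i.+1) 0)).
  have x_le i l : (i <= l)%N -> x_ i <= x_ l.
    by move=> il; rewrite lerD2l ler_pM2r// ler_nat.
  rewrite (big_cat_nat _ jm)//= [X in _ + X]big_nat_cond [X in _ + X]big1 ?addr0.
    apply: eq_big_nat => i /andP[_ ij]; rewrite max_l// subr_ge0.
    by apply: le_trans xj1; exact: x_le.
  move=> i /andP[/andP[ji _] _]; rewrite max_r ?mulr0// subr_le0.
  by apply: le_trans xj2 _; exact: x_le.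
have up : h x <= h (x_ j) + s j * (x - x_ j).
  have [->|nx] := eqVneq x (x_ j); first by rewrite subrr mulr0 addr0.
  have [->|nx'] := eqVneq x (x_ j.+1).
    by rewrite [in x_ j.+1 - _]x_S addrAC subrr add0r sE; lra.
  have l1 : x_ j < x by rewrite lt_neqAle eq_sym nx.
  have l2 : x < x_ j.+1 by rewrite lt_neqAle nx'.
  have := convex_three_slopes ch l1 l2.
  have -> : x_ j.+1 - x_ j = d by rewrite x_S; ring.
  have -> : h (x_ j.+1) = h (x_ j) + s j * d by rewrite sE; ring.
  have -> : x_ j.+1 - x = d - (x - x_ j) by rewrite x_S; ring.
  by move=> hh; rewrite -(ler_pM2l d0); lra.
have low : h (x_ j) + q (- T) * (x - x_ j) <= h x.
  apply: le_trans (qP (x_ j) x); rewrite lerD2l ler_wpM2r ?subr_ge0//.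
  apply: q_mono; rewrite /x_ lerDl mulr_ge0// ltW//.
have sj : s j <= q (T + 1).
  have : q (x_ j.+1) <= q (T + 1) by apply: q_mono; rewrite x_S; lra.
  apply: le_trans; rewrite -(ler_pM2r d0) sE.
  by have := qP (x_ j.+1) (x_ j); rewrite [in _ - x_ j.+1]x_S; lra.
rewrite kE ger0_norm; last lra.
apply: le_trans dK.
have xd : x - x_ j <= d by rewrite x_S in xj2; lra.
have xd0 : 0 <= x - x_ j by lra.
apply: (@le_trans _ _ (K * (x - x_ j))); last by rewrite mulrC ler_wpM2r//; lra.
have := ler_wpM2r xd0 sj; rewrite /K; lra.
Qed.

(** Moving a nearly nearest point of one hypograph down by [e] puts it in the
other one. *)
Lemma hypograph_dist_stable f f' (T e : R) z : 0 <= e ->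
  (forall t, `|t| <= T -> f t <= f' t + e) ->
  `|z.1| + Num.max (z.2 - f z.1) 0 + 1 <= T ->
  euclid_dist (hypograph f') z <= euclid_dist (hypograph f) z + e.
Proof.
move=> e0 ff zT; apply/ler_addgt0Pr => eta eta0.
have eta'0 : 0 < Num.min eta 1 by rewrite lt_min eta0 ltr01.
have [b Hb zb] := euclid_dist_near z (hypograph_nonempty f) eta'0.
have m1 : Num.min eta 1 <= 1 by rewrite ge_min lexx orbT.
have m2 : Num.min eta 1 <= eta by rewrite ge_min lexx.
have bT : `|b.1| <= T.
  have := hypograph_dist_le_vertical f z.
  have := ler_fst_euclid_norm (z - b).
  have := ler_normB z.1 (z.1 - b.1); rewrite /= opprB subrKC; lra.
have Hb' : hypograph f' (b - (0, e)).
  by rewrite /hypograph/= subr0 lerBlDr; apply: le_trans (ff _ bT).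
apply: le_trans (euclid_dist_le z Hb') _; rewrite opprB addrCA.
apply: le_trans (euclid_norm_triangle _ _) _.
have -> : euclid_norm ((0, e) : plane R) = e.
  by rewrite /euclid_norm/= expr0n/= add0r sqrtr_sqr ger0_norm.
by lra.
Qed.

(** * The distance to a DC hypograph *)

Lemma hypograph_dist_convex_of_hinge g k (o : plane R) : @convex_fun R R^o g ->
  is_hinge k -> hypograph (fun x => g x - k x) o -> o.1 = 0 ->
  exists Phi : plane R -> R, [/\ convex_fun Phi, forall z, 0 <= Phi z,
    (forall z rho, 1 <= rho -> 4 * euclid_norm (z - o) <= rho ->
      Phi z <= (2 + 4 * rho) * (k (2 * rho) + k (- (2 * rho)) - 2 * k 0)) &
    convex_fun (fun z => Phi z - euclid_dist (hypograph (fun x => g x - k x)) z +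
      Num.max (z.2 + k z.1) (g z.1))].
Proof.
move=> cg [m [A [B [c [a [c0 inja ->]]]]]] Ho o1.
exists (kink_sum A B c a cg o); split.
- exact: kink_sum_convex.
- exact: kink_sum_ge0.
- by move=> z rho; exact: kink_sum_le.
- exact: kink_sum_sub_dist_convex.
Qed.

Let large_index (T e : R) : 0 < e ->
  exists N, forall n, (N <= n)%N -> T <= n.+1%:R /\ n.+1%:R^-1 < e.
Proof.
move=> e0; exists (maxn (Num.truncn T) (Num.truncn e^-1)) => n.
rewrite geq_max => /andP[n1 n2]; split.
  by apply: le_trans (ltW (truncnS_gt T)) _; rewrite ler_nat.
rewrite invf_plt ?posrE// (lt_le_trans (truncnS_gt _))// ler_nat//.
Qed.

(** The limit superior of the convex functions Phi_n - d_n + max (y + h_n, g) is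
that of the Phi_n plus the limit of the rest. *)
Lemma hypograph_dist_diff_convex g h :
  @convex_fun R R^o g -> @convex_fun R R^o h ->
  exists P Q : plane R -> R, [/\ convex_fun P, convex_fun Q &
    forall z, euclid_dist (hypograph (fun x => g x - h x)) z = P z - Q z].
Proof.
move=> cg ch; pose f x := g x - h x.
(* Lies in all the approximating hypographs, whose functions are within 1 of f
   at 0. *)
pose o : plane R := (0, f 0 - 1).
have inv1 (n : nat) : n.+1%:R^-1 <= 1 :> R by rewrite invf_le1// ler1n.
have inv0 (n : nat) : 0 < n.+1%:R^-1 :> R by rewrite invr_gt0.
have : forall n : nat, exists p : (R -> R) * (plane R -> R),
    [/\ forall x, `|x| <= n.+1%:R -> `|p.1 x - h x| <= n.+1%:R^-1,
     convex_fun p.2, forall z, 0 <= p.2 z,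
    (forall z rho, 1 <= rho -> 4 * euclid_norm (z - o) <= rho ->
      p.2 z <= (2 + 4 * rho) * (p.1 (2 * rho) + p.1 (- (2 * rho)) - 2 * p.1 0)) &
    convex_fun (fun z => p.2 z - euclid_dist (hypograph (fun x => g x - p.1 x)) z +
      Num.max (z.2 + p.1 z.1) (g z.1))].
  move=> n; have [k hk kh] := hinge_approx ch (ltr0Sn R n) (inv0 n).
  have Ho : hypograph (fun x => g x - k x) o.
    rewrite /hypograph /o/= /f; have := kh 0; rewrite normr0 ler_norml => /(_ (ler0n _ _)).
    by have := inv1 n; move: n.+1%:R^-1 => eps; lra.
  have [Phi [cP P0 Pb cM]] := hypograph_dist_convex_of_hinge cg hk Ho erefl.
  by exists (k, Phi).
move=> /choice[p pP].
pose kn n := (p n).1; pose Phi n := (p n).2.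
pose dn n z := euclid_dist (hypograph (fun x => g x - kn n x)) z.
have kh n x : `|x| <= n.+1%:R -> `|kn n x - h x| <= n.+1%:R^-1.
  by have [+ _ _ _ _] := pP n; apply.
have cPhi n : convex_fun (Phi n) by have [_ C _ _ _] := pP n; exact: C.
have Phi0 n z : 0 <= Phi n z by have [_ _ C _ _] := pP n; exact: C.
have cM n : convex_fun (fun z => Phi n z - dn n z + Num.max (z.2 + kn n z.1) (g z.1)).
  by have [_ _ _ _ C] := pP n; exact: C.
have /choice[L LP] : forall z, exists L, is_limsup (Phi ^~ z) L.
  move=> z; pose rho := Num.max 1 (4 * euclid_norm (z - o)).
  have rho1 : 1 <= rho by rewrite le_max lexx.
  have rhoz : 4 * euclid_norm (z - o) <= rho by rewrite le_max lexx orbT.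
  apply: (@is_limsup_exists _ _ 0
    ((2 + 4 * rho) * (h (2 * rho) + h (- (2 * rho)) - 2 * h 0 + 4))).
  have [N NP] := large_index (2 * rho) (ltr01 : 0 < 1 :> R).
  exists N => n /NP[nT _]; rewrite Phi0/=.
  have [_ _ _ Pb _] := pP n; apply: le_trans (Pb z rho rho1 rhoz) _.
  rewrite ler_wpM2l//; first lra.
  have := kh n (2 * rho); have := kh n (- (2 * rho)); have := kh n 0.
  rewrite normrN normr0 (_ : `|2 * rho| = 2 * rho); last by rewrite ger0_norm//; lra.
  move=> /(_ (ler0n _ _)) k0 /(_ nT) k1 /(_ nT) k2.
  move: k0 k1 k2; rewrite !ler_norml -/(kn n); have := inv1 n.
  by move: n.+1%:R^-1 => eps; lra.
pose V z := Num.max (z.2 + h z.1) (g z.1) : R.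
have cV : convex_fun V.
  apply: convex_fun_max; last by move=> x y t t0 t1; exact: cg.
  apply: convex_funD; first by move=> x y t _ _; rewrite /= /GRing.scale/=; lra.
  by move=> x y t t0 t1; exact: ch.
have cL : convex_fun L by exact: (convex_limsup cPhi LP).
pose d z := euclid_dist (hypograph f) z.
exists (fun z => L z + V z), (fun z => L z + (V z - d z)); split.
- exact: convex_funD.
- apply: (@convex_limsup _ _
    (fun n z => Phi n z + (Num.max (z.2 + kn n z.1) (g z.1) - dn n z))).
    by move=> n; apply: eq_convex_fun (cM n) => z; ring.
  move=> z; apply: is_limsup_add (LP z) _ => e e0.
  pose T := `|z.1| + Num.max (z.2 - f z.1) 0 + 2.
  have M0 : 0 <= Num.max (z.2 - f z.1) 0 by rewrite le_max lexx orbT.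
  have e20 : 0 < e / 2 by lra.
  have [N NP] := large_index T e20; exists N => n /NP[nT ne].
  set eps : R := n.+1%:R^-1 in ne *.
  have kz t : `|t| <= T -> `|kn n t - h t| <= eps.
    by move=> tT; apply: kh; exact: le_trans nT.
  have zT : `|z.1| <= T by rewrite /T; lra.
  have eps1 : eps <= 1 by exact: inv1.
  have eps0 : 0 <= eps by exact/ltW/inv0.
  have kzz := kz _ zT; rewrite ler_norml in kzz.
  have d1 : dn n z <= d z + eps.
    apply: (@hypograph_dist_stable _ _ T) => // [t /kz|].
      by rewrite ler_norml /f; lra.
    by rewrite /T; lra.
  have d2 : d z <= dn n z + eps.
    apply: (@hypograph_dist_stable _ _ T) => // [t /kz|].
      by rewrite ler_norml /f; lra.
    rewrite /T -!addrA lerD2l; have : Num.max (z.2 - (g z.1 - kn n z.1)) 0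
        <= Num.max (z.2 - f z.1) 0 + eps.
      have m1 : z.2 - f z.1 <= Num.max (z.2 - f z.1) 0 by rewrite le_max lexx.
      by rewrite ge_max /f in m1 *; apply/andP; split; lra.
    by lra.
  have m1 : z.2 + h z.1 <= V z by rewrite le_max lexx.
  have m2 : g z.1 <= V z by rewrite le_max lexx orbT.
  have v1 : Num.max (z.2 + kn n z.1) (g z.1) <= V z + eps.
    by rewrite ge_max; apply/andP; split; lra.
  have m3 : z.2 + kn n z.1 <= Num.max (z.2 + kn n z.1) (g z.1) by rewrite le_max lexx.
  have m4 : g z.1 <= Num.max (z.2 + kn n z.1) (g z.1) by rewrite le_max lexx orbT.
  have v2 : V z <= Num.max (z.2 + kn n z.1) (g z.1) + eps.
    by rewrite ge_max; apply/andP; split; lra.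
  by rewrite ltr_norml; lra.
- by move=> z; rewrite -/f -/(d z); ring.
Qed.

End Approximation.

Theorem theorem3p3 (R : realType) (f : R -> R)
  (f_DC : @DC R R^o [set: R^o] f) :
  @DC R (plane R) [set: plane R] (euclid_dist (graph f)).
Proof.
have [g [h [/convex_funP cg /convex_funP ch fE]]] := f_DC.
have fgh : f = fun x => g x - h x by apply/funext => x; exact: fE.
have fhg : (fun x => - f x) = fun x => h x - g x.
  by apply/funext => x; rewrite fE// opprB.
have cf : continuous f.
  by move=> x; rewrite fgh; apply: cvgB; exact: convex_continuous.
have [P1 [Q1 [cP1 cQ1 D1]]] := hypograph_dist_diff_convex cg ch.
have [P2 [Q2 [cP2 cQ2 D2]]] := hypograph_dist_diff_convex ch cg.
have reflect (F : plane R -> R) :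
    convex_fun F -> convex_fun (fun z : plane R => F (z.1, - z.2)).
  move=> cF x y t t0 t1.
  rewrite [X in F X](_ : _ = t *: ((x.1, - x.2) : plane R) + (1 - t) *: (y.1, - y.2)).
    exact: cF.
  by congr (_, _); rewrite /= /GRing.scale/=; ring.
exists (fun z => P1 z + P2 (z.1, - z.2)), (fun z => Q1 z + Q2 (z.1, - z.2)); split.
- by apply/convex_funP; apply: convex_funD => //; exact: reflect.
- by apply/convex_funP; apply: convex_funD => //; exact: reflect.
- move=> z _; rewrite graph_dist_split// fhg [in X in X + _]fgh D1 D2; ring.
Qed.
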